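(* For one or several VIPAs of capacity $\mathrm{Cap}$ operating in tram mode on a directed circuit $C$ with distinguished origin $v_0$ (the parking), the online algorithm $SIF_M$ is $1$-competitive with respect to minimizing the total tour length during the morning scenario, and the online algorithm $SIF_E$ is $1$-competitive with respect to minimizing the total tour length during the evening scenario.
   Context: A request is $r_j=(t_j,x_j,y_j,z_j)$: released at time $t_j$ (and only then known to the online algorithm), with origin $x_j$, destination $y_j$ and $z_j$ passengers. VIPAs have capacity $\mathrm{Cap}$ and unit speed. A feasible transportation schedule gives each VIPA one tour starting and ending at $v_0$, carrying every passenger from origin to destination, never serving a request before its release. Total tour length is the sum of tour lengths. In tram mode VIPAs move only along $C$ in its fixed direction and may wait or stop at stations. An online algorithm ALG is $c$-competitive if $ALG(\sigma)\le c\cdot OPT(\sigma)$ for every request sequence $\sigma$, where $OPT(\sigma)$ is the optimal offline total tour length. Morning scenario: every request has origin $x_j=v_0$. Evening scenario: every request has destination $y_j=v_0$. $SIF_M$ (''Start if fully loaded'', morning): each VIPA waits at the parking until $\mathrm{Cap}$ passengers have entered; as soon as it is fully loaded it starts a full round of $C$ and stops at stations where passengers request to leave. $SIF_E$ (''Start if fully loaded'', evening): each VIPA waits at the parking until enough requests are released to reach $\mathrm{Cap}$ passengers; then it starts a full round, stops at stations where passengers request to enter, and returns (fully loaded) to the parking. *)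

(* Defs.v *)
From HB Require Import structures.
From mathcomp Require Import all_boot all_order all_algebra.
From mathcomp Require Import boolp classical_sets reals.
Set Implicit Arguments.
Unset Strict Implicit.
Unset Printing Implicit Defensive.
Import Order.TTheory GRing.Theory Num.Theory.
Local Open Scope classical_set_scope.
Local Open Scope ring_scope.

(* The stations of the circuit are v_0, ..., v_n, encoded by 'I_n.+1, with the *)
(* parking v_0 = ord0; len i is the length of the arc from v_i to its          *)
(* successor (v_0 when i = n).                                                 *)

Record request (R : realType) (n : nat) := Request {
  release : R;
  origin : 'I_n.+1;
  destination : 'I_n.+1;
  load : nat }.

(* A passenger is represented by (a copy of) the request it belongs to.  The   *)
(* passengers of one request may travel in different VIPAs or rounds.          *)
Definition passengers (R : realType) (n : nat) (sigma : seq (request R n)) :=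
  flatten [seq nseq (load r) r | r <- sigma].

Definition request_sequence (R : realType) (n : nat)
    (sigma : seq (request R n)) : bool :=
  sorted (fun r1 r2 => release r1 <= release r2) sigma
  && all (fun r => origin r != destination r) sigma.

Definition morning (R : realType) (n : nat) (r : request R n) : bool :=
  origin r == ord0.

Definition evening (R : realType) (n : nat) (r : request R n) : bool :=
  destination r == ord0.

(* A passenger boards VIPA [vipa] just before its move number [board] and      *)
(* leaves it just after its move number [alight] - 1.                          *)
Record ride (k : nat) := Ride { vipa : 'I_k; board : nat; alight : nat }.

(* In tram mode a tour from v_0 is determined by the times at which the VIPA   *)
(* departs for its successive moves: move number p uses the arc leaving        *)
(* v_(p mod n.+1) = inZp p, and between two moves the VIPA is at a station.    *)
(* [rides] lists the rides of the passengers in the order of [passengers].     *)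
Record schedule (R : realType) (k : nat) := Schedule {
  tours : 'I_k -> seq R;
  rides : seq (ride k) }.

Section Circuit.
Variables (R : realType) (n k Cap : nat) (len : 'I_n.+1 -> R).

Definition tour_length (t : seq R) : R := \sum_(p < size t) len (inZp p).

Definition is_tour (t : seq R) : Prop :=
  [/\ (n.+1 %| size t)%N,
      forall p, (p < size t)%N -> 0 <= t`_p
    & forall p, (p.+1 < size t)%N -> t`_p + len (inZp p) <= t`_p.+1].

Definition serves (tr : 'I_k -> seq R) (r : request R n) (d : ride k) : bool :=
  [&& (board d < alight d <= size (tr (vipa d)))%N,
      inZp (board d) == origin r,
      inZp (alight d) == destination r
    & release r <= (tr (vipa d))`_(board d)].

Definition occupancy (S : schedule R k) (i : 'I_k) (p : nat) : nat :=
  count (fun d => (vipa d == i) && (board d <= p < alight d)%N) (rides S).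

Definition feasible (sigma : seq (request R n)) (S : schedule R k) : Prop :=
  [/\ forall i, is_tour (tours S i),
      all2 (serves (tours S)) (passengers sigma) (rides S)
    & forall i p, (occupancy S i p <= Cap)%N].

Definition total_tour_length (S : schedule R k) : R :=
  \sum_(i < k) tour_length (tours S i).

Definition OPT (sigma : seq (request R n)) : R :=
  inf [set total_tour_length S | S in [set S | feasible sigma S]].

Definition competitive (c : R) (scenario : pred (request R n))
    (ALG : seq (request R n) -> schedule R k) : Prop :=
  forall sigma, request_sequence sigma -> all scenario sigma ->
    total_tour_length (ALG sigma) <= c * OPT sigma.

(* From here on, [starts i] lists the times at which VIPA i has started its    *)
(* full rounds so far.                                                         *)

Definition perimeter : R := \sum_(i < n.+1) len i.

Definition back_at (starts : 'I_k -> seq R) (i : 'I_k) : R :=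
  if starts i is s :: ss then last s ss + perimeter else 0.

Definition start_time (starts : 'I_k -> seq R) (t : R) (i : 'I_k) : R :=
  Num.max t (back_at starts i).

(* [pick starts t] is the VIPA taking the load that is complete at time t; the *)
(* algorithms leave it open which of several suitable VIPAs this is.           *)
Definition prompt (pick : ('I_k -> seq R) -> R -> 'I_k) : Prop :=
  forall starts t i, start_time starts t (pick starts t) <= start_time starts t i.

(* Departure times of a full round started at time s without extra waiting.    *)
Definition full_round (s : R) : seq R :=
  [seq s + \sum_(j < p) len (inZp j) | p <- iota 0 n.+1].

Record state := State {
  starts_of : 'I_k -> seq R;
  taken : seq (ride k);
  waiting : seq (request R n) }.

Variable pick : ('I_k -> seq R) -> R -> 'I_k.

(* [stops q r] gives the boarding and alighting positions of a passenger of    *)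
(* request r travelling in the round number q of its VIPA.                     *)
Variable stops : nat -> request R n -> nat * nat.

Definition dispatch (t : R) (st : state) : state :=
  let i := pick (starts_of st) t in
  let q := size (starts_of st i) in
  State
    (fun j => if j == i then rcons (starts_of st i) (start_time (starts_of st) t i)
              else starts_of st j)
    (taken st ++ [seq Ride i (stops q r).1 (stops q r).2 | r <- waiting st])
    [::].

Definition arrive (st : state) (r : request R n) : state :=
  let st' := State (starts_of st) (taken st) (rcons (waiting st) r) in
  if size (waiting st') == Cap then dispatch (release r) st' else st'.

(* With [closing = None], passengers left over at the end (fewer than Cap)     *)
(* wait forever.  With [closing = Some t], they travel in one last, not fully  *)
(* loaded round once the service closes, at time t or at the last release if   *)
(* that is later.                                                              *)
Definition close (closing : option R) (st : state) : state :=
  if closing is Some t then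
    if waiting st is [::] then st
    else dispatch (foldr Num.max t [seq release r | r <- waiting st]) st
  else st.

Definition SIF (closing : option R) (sigma : seq (request R n)) : schedule R k :=
  let st := close closing
    (foldl arrive (State (fun=> [::]) [::] [::]) (passengers sigma)) in
  Schedule (fun i => flatten [seq full_round s | s <- starts_of st i]) (taken st).

End Circuit.

Definition SIF_M (R : realType) (n k Cap : nat) (len : 'I_n.+1 -> R)
    (pick : ('I_k -> seq R) -> R -> 'I_k) (closing : option R) :=
  SIF Cap len pick
    (fun q r => (q * n.+1, q * n.+1 + destination r)%N) closing.

Definition SIF_E (R : realType) (n k Cap : nat) (len : 'I_n.+1 -> R)
    (pick : ('I_k -> seq R) -> R -> 'I_k) (closing : option R) :=
  SIF Cap len pick
    (fun q r => (q * n.+1 + origin r, q.+1 * n.+1)%N) closing.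

(* Without a closing round, a run of SIF serves everybody exactly when the     *)
(* number of passengers is a multiple of Cap.                                  *)
Definition completes (R : realType) (n k Cap : nat) (len : 'I_n.+1 -> R)
    (closing : option R) (scenario : pred (request R n))
    (ALG : seq (request R n) -> schedule R k) : Prop :=
  forall sigma, request_sequence sigma -> all scenario sigma ->
    closing \/ (Cap %| size (passengers sigma))%N ->
    feasible Cap len sigma (ALG sigma).

(* Main.v *)
(** In tram mode every tour consists of full rounds, so its length is the
    perimeter times its number of rounds.  A morning passenger boards at the
    parking, hence crosses the first arc of some round; an evening passenger
    leaves at the parking, hence crosses the last arc of some round.  As this arc
    carries at most [Cap] passengers per round, any feasible schedule of [P]
    passengers has at least [P / Cap] rounds.  SIF starts a round for each full
    load, plus at most one for the remaining passengers.  Since [inf] of the empty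
    set is [0], the bound on [OPT] also needs a feasible schedule; SIF itself with
    a closing round provides one. *)
Require Import Defs.
From HB Require Import structures.
From mathcomp Require Import all_boot all_order all_algebra.
From mathcomp Require Import boolp classical_sets reals.
From mathcomp Require Import zify.
Set Implicit Arguments.
Unset Strict Implicit.
Unset Printing Implicit Defensive.
Import Order.TTheory GRing.Theory Num.Theory.
Local Open Scope ring_scope.

(** * Lists, and the release order of the passengers *)

Lemma all2_cat (S T : Type) (r : S -> T -> bool) (s1 s2 : seq S) (t1 t2 : seq T) :
  all2 r s1 t1 -> all2 r s2 t2 -> all2 r (s1 ++ s2) (t1 ++ t2).
Proof.
by elim: s1 t1 => [|x s1 IH] [|y t1] //= /andP[-> /IH h] /h.
Qed.

Lemma sub_all2 (S T : Type) (r1 r2 : S -> T -> bool) (s : seq S) (t : seq T) :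
  (forall x y, r1 x y -> r2 x y) -> all2 r1 s t -> all2 r2 s t.
Proof.
by move=> h; elim: s t => [|x s IH] [|y t] //= /andP[/h-> /IH].
Qed.

Lemma sub_all2_all (S T : Type) (r : S -> T -> bool) (a : pred S) (b : pred T)
    (s : seq S) (t : seq T) :
  (forall x y, a x -> r x y -> b y) -> all a s -> all2 r s t -> all b t.
Proof.
by move=> h; elim: s t => [|x s IH] [|y t] //= /andP[/h{}h /IH{}IH] /andP[/h-> /IH].
Qed.

Lemma size_all2 (S T : Type) (r : S -> T -> bool) (s : seq S) (t : seq T) :
  all2 r s t -> size s = size t.
Proof. by rewrite all2E => /andP[/eqP]. Qed.

Lemma all_flatten_nseq (T : Type) (a : pred T) (f : T -> nat) (s : seq T) :
  all a s -> all a (flatten [seq nseq (f x) x | x <- s]).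
Proof.
by elim: s => //= x s IH /andP[ax /IH]; rewrite all_cat all_nseq ax orbT.
Qed.

Lemma pairwise_flatten_nseq (T : Type) (e : rel T) (f : T -> nat) (s : seq T) :
  reflexive e -> pairwise e s -> pairwise e (flatten [seq nseq (f x) x | x <- s]).
Proof.
move=> e_refl; elim: s => //= x s IH /andP[xs /IH {}IH].
rewrite pairwise_cat IH andbT; apply/andP; split.
  by rewrite /allrel all_nseq /= all_flatten_nseq ?orbT.
by elim: (f x) => //= m ->; rewrite all_nseq e_refl orbT.
Qed.

Lemma passengers_pairwise (R : realType) (n : nat) (sigma : seq (request R n)) :
  request_sequence sigma ->
  pairwise (fun r1 r2 => release r1 <= release r2) (passengers sigma).
Proof.
case/andP=> + _; rewrite sorted_pairwise; last by move=> ? ? ?; apply: le_trans.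
by apply: pairwise_flatten_nseq => r; apply: lexx.
Qed.

(** * Tours made of full rounds: length and timing *)

Section Tours.
Variables (R : realType) (n k : nat) (len : 'I_n.+1 -> R).
Hypothesis len_gt0 : forall i, 0 < len i.

Lemma perimeter_ge0 : 0 <= perimeter len.
Proof. by apply: sumr_ge0 => i _; apply: ltW. Qed.

Lemma inZp_mulDl (q p : nat) : inZp (q * n.+1 + p) = inZp p :> 'I_n.+1.
Proof. by apply: val_inj; rewrite /= modnMDl. Qed.

Lemma tour_length_rounds (t : seq R) (m : nat) :
  size t = (m * n.+1)%N -> tour_length len t = perimeter len *+ m.
Proof.
rewrite /tour_length => ->.
(* The moves split into [m] blocks of [n.+1], each running once over all arcs. *)
rewrite -(big_mkord xpredT (fun p => len (inZp p))) big_nat_mul.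
rewrite (eq_bigr (fun=> perimeter len)); first by rewrite sumr_const_nat subn0.
move=> q _; rewrite -{1}[(q * _)%N]add0n big_addn mulSn addnK big_mkord.
by apply: eq_bigr => i _; rewrite addnC inZp_mulDl valZpK.
Qed.

Lemma size_full_round (s : R) : size (full_round len s) = n.+1.
Proof. by rewrite size_map size_iota. Qed.

Lemma nth_full_round (s : R) (p : nat) : (p < n.+1)%N ->
  (full_round len s)`_p = s + \sum_(j < p) len (inZp j).
Proof. by move=> lt_p; rewrite (nth_map 0%N) ?size_iota // nth_iota. Qed.

Definition rounds (ss : seq R) : seq R := flatten [seq full_round len s | s <- ss].

Lemma size_rounds (ss : seq R) : size (rounds ss) = (size ss * n.+1)%N.
Proof.
elim: ss => // s ss IH.
by rewrite -[rounds _]/(full_round len s ++ rounds ss) size_cat IH size_full_round.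
Qed.

Lemma rounds_rcons (ss : seq R) (s : R) :
  rounds (rcons ss s) = rounds ss ++ full_round len s.
Proof. by rewrite /rounds map_rcons flatten_rcons. Qed.

(* The last clause says that the VIPA has completed its tour when [back_at]
   declares it available again. *)
Definition sound_starts (starts : 'I_k -> seq R) (i : 'I_k) : Prop :=
  [/\ is_tour len (rounds (starts i)), 0 <= back_at len starts i
    & forall p, p.+1 = size (rounds (starts i)) ->
        (rounds (starts i))`_p + len (inZp p) <= back_at len starts i].

(** Inside a full round consecutive departures differ by exactly the arc length, so the only
    delicate spot is the junction with the previous round, where [back_at] bounds the last
    arrival. *)
Lemma sound_starts_rcons (starts starts' : 'I_k -> seq R) (i : 'I_k) (s : R) :
  sound_starts starts i -> back_at len starts i <= s ->
  starts' i = rcons (starts i) s -> sound_starts starts' i.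
Proof.
move=> [[_ t_ge0 t_step] b_ge0 t_last] le_bs E.
have s_ge0 : 0 <= s by apply: le_trans le_bs.
have Eb : back_at len starts' i = s + perimeter len.
  by rewrite /back_at E; case: (starts i) => //= x ss; rewrite last_rcons.
rewrite /sound_starts /is_tour Eb E rounds_rcons size_cat size_full_round.
have sz := size_rounds (starts i).
set T := rounds (starts i) in sz t_ge0 t_step t_last *.
have nthR p : (size T <= p < size T + n.+1)%N ->
    (T ++ full_round len s)`_p = s + \sum_(j < p - size T) len (inZp j).
  by move=> /andP[h1 h2]; rewrite nth_cat ltnNge h1 /= nth_full_round // ; lia.
have Zp p : (size T <= p)%N -> inZp p = inZp (p - size T) :> 'I_n.+1.
  by move=> h; rewrite -[in LHS](subnKC h) sz inZp_mulDl.
have sum_ge0 p : 0 <= \sum_(j < p) len (inZp j).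
  by apply: sumr_ge0 => j _; apply: ltW.
split; [split | by rewrite addr_ge0 ?perimeter_ge0 |].
- by rewrite sz dvdn_add ?dvdn_mull.
- move=> p lt_p; case: (ltnP p (size T)) => h; first by rewrite nth_cat h t_ge0.
  by rewrite nthR ?h // addr_ge0.
- move=> p lt_p; case: (ltnP p.+1 (size T)) => h.
    by rewrite !nth_cat h ltnW // t_step.
  rewrite [X in _ <= X]nthR ?h //; case: (ltnP p (size T)) => h'.
    have e : p.+1 = size T by apply/eqP; rewrite eqn_leq h' h.
    rewrite nth_cat h' e subnn big_ord0 addr0.
    by apply: le_trans le_bs; apply: t_last.
  rewrite nthR ?h' ?(ltnW lt_p) // subSn // big_ord_recr /= addrA.
  by rewrite (Zp p).
- move=> p Ep; have le_p : (size T <= p)%N by lia.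
  rewrite nthR; last by lia.
  (* The final move has offset [n] in the new round; the arcs up to and including it add up to the
     perimeter. *)
  rewrite (Zp p) // (_ : p - size T = n)%N; last by lia.
  rewrite /perimeter big_ord_recr /= -addrA lerD2l.
  rewrite (_ : ord_max = inZp n); last by apply: val_inj; rewrite /= modn_small.
  by rewrite lerD2r; apply: ler_sum => j _; rewrite -[X in _ <= len X]valZpK.
Qed.

End Tours.

(** Double counting: [e] is an offset within the rounds. The occupancies at this offset, summed over
    all VIPAs and rounds, count every ride at least once, and each is at most [Cap]. *)
Lemma rounds_needed (R : realType) (n k Cap e : nat) (S : schedule R k)
    (m : 'I_k -> nat) :
  (forall i p, (occupancy S i p <= Cap)%N) ->
  all (fun d => [exists q : 'I_(m (vipa d)), board d <= q * n.+1 + e < alight d])%N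
    (rides S) ->
  (size (rides S) <= (\sum_i m i) * Cap)%N.
Proof.
move=> occ crossing.
apply: (@leq_trans (\sum_i \sum_(q < m i) occupancy S i (q * n.+1 + e))%N); last first.
  rewrite big_distrl /=; apply: leq_sum => i _.
  apply: (@leq_trans (\sum_(q < m i) Cap)%N); first exact: leq_sum.
  by rewrite sum_nat_const card_ord.
rewrite /occupancy; elim: (rides S) crossing => //= d ds IH /andP[/existsP[q hq] /IH{}IH].
under eq_bigr do rewrite big_split /=.
rewrite big_split /= -add1n leq_add // (bigD1 (vipa d)) //= eqxx (bigD1 q) //=.
by rewrite hq.
Qed.

(** * The invariant of a run of SIF *)

Section Run.
Variables (R : realType) (n k Cap : nat) (len : 'I_n.+1 -> R).
Hypotheses (len_gt0 : forall i, 0 < len i) (Cap_gt0 : (0 < Cap)%N).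
Variables (pick : ('I_k -> seq R) -> R -> 'I_k)
  (stops : nat -> request R n -> nat * nat) (valid : pred (request R n)).
(** Common interface of the two algorithms: a passenger assigned to round [q] rides only on moves of
    that round, between the right stations. *)
Hypothesis stops_valid : forall q r, valid r ->
  [/\ (q * n.+1 <= (stops q r).1)%N, ((stops q r).1 < (stops q r).2 <= q.+1 * n.+1)%N,
      inZp (stops q r).1 = origin r & inZp (stops q r).2 = destination r].

Local Notation state := (state R n k).
Local Notation dispatch := (dispatch len pick stops).
Local Notation arrive := (arrive Cap len pick stops).
Local Notation close := (close len pick stops).
Local Notation run := (foldl arrive (State (fun=> [::]) [::] [::])).

Definition schedule_of (st : state) : schedule R k :=
  Schedule (fun i => rounds len (starts_of st i)) (taken st).

(** The invariant: feasibility up to a final segment of [ps] that still waits, plus the timing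
    needed to append a round. Loads are filled in order of arrival, so the served passengers form a
    prefix. *)
Definition sound (ps : seq (request R n)) (st : state) : Prop :=
  [/\ forall i, sound_starts len (starts_of st) i,
      exists2 served, ps = served ++ waiting st
        & all2 (serves (tours (schedule_of st))) served (taken st)
    & forall i p, (occupancy (schedule_of st) i p <= Cap)%N].

(** Appending a round leaves earlier departures untouched. On the chosen VIPA old rides end before
    the new round and new ones stay inside it, so they never share a move. *)
Lemma sound_dispatch (ps : seq (request R n)) (st : state) (t : R) :
  sound ps st -> all valid (waiting st) ->
  all (fun r => release r <= t) (waiting st) -> (size (waiting st) <= Cap)%N ->
  sound ps (dispatch t st).
Proof.
case=> st_starts [served Eps st_serves] st_occ wvalid wrel wCap.
rewrite /dispatch; set i := pick _ _; set s := start_time _ _ _ _.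
set q := size (starts_of st i); set new := [seq _ | r <- waiting st].
set starts' := fun j => _.
have Ei : starts' i = rcons (starts_of st i) s by rewrite /starts' eqxx.
have Ej j : j != i -> starts' j = starts_of st j by rewrite /starts' => /negPf->.
have tours' j : exists u, rounds len (starts' j) = rounds len (starts_of st j) ++ u.
  have [->|/Ej->] := eqVneq j i; last by exists [::]; rewrite cats0.
  by rewrite Ei rounds_rcons; eexists.
have new_in r : valid r -> let d := Ride i (stops q r).1 (stops q r).2 in
    (q * n.+1 <= board d)%N && (board d < alight d <= q.+1 * n.+1)%N.
  by move=> /(stops_valid q)[h1 h2 _ _]; rewrite /= h1 h2.
split.
- move=> j; rewrite [starts_of _]/=; have [->|ji] := eqVneq j i.
    by apply: sound_starts_rcons Ei => //; rewrite le_max lexx orbT.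
  by move: (st_starts j); rewrite /sound_starts /back_at Ej.
- exists (served ++ waiting st); first by rewrite /= cats0.
  apply: all2_cat.
    apply: sub_all2 st_serves => r d; rewrite /serves /=.
    case/and4P=> /andP[lt_ba le_as] -> -> rel_r.
    have [u ->] := tours' (vipa d).
    rewrite lt_ba size_cat (leq_trans le_as) ?leq_addr //=.
    by rewrite nth_cat (leq_trans lt_ba le_as).
  rewrite /new; elim: (waiting st) wvalid wrel => //= r w IH.
  case/andP=> vr /IH{}IH /andP[rt /IH->]; rewrite andbT /serves /=.
  have [h1 /andP[h2 h3] -> ->] := stops_valid q vr.
  rewrite !eqxx h2 Ei rounds_rcons size_cat size_rounds size_full_round -/q /=.
  rewrite addnC -mulSn h3 /= nth_cat size_rounds -/q ltnNge h1 /=.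
  rewrite nth_full_round; last by rewrite ltn_subLR // addnC -mulSn (leq_trans h2).
  (* Boarding happens no earlier than the start [s] of the round, and [s] is at least [t]. *)
  apply: (le_trans rt); apply: (@le_trans _ _ s); first by rewrite le_max lexx.
  by rewrite lerDl; apply: sumr_ge0 => j _; apply: ltW.
- move=> j p; rewrite /occupancy /= count_cat.
  have [->|ji] := eqVneq j i; last first.
    rewrite (_ : count _ new = 0%N) ?addn0; first exact: st_occ.
    by rewrite count_map (@eq_count _ _ pred0) ?count_pred0 // => r /=; rewrite eq_sym (negPf ji).
  case: (ltnP p (q * n.+1)) => hp.
    rewrite (_ : count _ new = 0%N) ?addn0; first exact: st_occ.
    apply/eqP; rewrite -leqn0 leqNgt -has_count has_map.
    apply/negP; elim: (waiting st) wvalid => //= r w IH /andP[/new_in vr /IH{}IH].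
    by case/orP => // h; move: vr h => /=; lia.
  rewrite (_ : count _ (taken st) = 0%N) ?add0n.
    by rewrite (leq_trans (count_size _ _)) // size_map.
  apply/eqP; rewrite -leqn0 leqNgt -has_count.
  have : all (fun d => alight d <= size (rounds len (starts_of st (vipa d))))%N (taken st).
    apply: sub_all2_all st_serves; last exact: (all_predT served).
    by move=> r d _ /and4P[/andP[]].
  move=> h; apply/negP; elim: (taken st) h => //= d ds IH /andP[hd /IH{}IH].
  case/orP => // /andP[/eqP Ed]; move: hd; rewrite Ed size_rounds -/q.
  by lia.
Qed.

Lemma sound_init : sound [::] (State (fun=> [::]) [::] [::]).
Proof.
split=> [i||i p]; [split=> //; split=> // | exists [::] => // | exact: leq0n].
Qed.

(** As passengers come in order of release, all members of a load are released by the time its last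
    one completes it. *)
Lemma sound_run (ps : seq (request R n)) :
  pairwise (fun r1 r2 => release r1 <= release r2) ps -> all valid ps ->
  sound ps (run ps) /\ (size (waiting (run ps)) < Cap)%N.
Proof.
elim/last_ind: ps => [|ps r IH]; first by move=> _ _; split; [exact: sound_init|].
rewrite pairwise_rcons all_rcons => /andP[rel_r /IH{}IH] /andP[vr vps].
have [Hs Hw] := IH vps; rewrite foldl_rcons /arrive /=.
set st := run ps in Hs Hw *; have [Hs1 [served Eps Hs2] Hs3] := Hs.
have Hs' : sound (rcons ps r) (State (starts_of st) (taken st) (rcons (waiting st) r)).
  by split=> //; exists served => //=; rewrite Eps rcons_cat.
move: rel_r vps; rewrite Eps !all_cat => /andP[_ rel_w] /andP[_ vw].
rewrite size_rcons; case: eqP => [E|/eqP E]; last first.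
  by split; rewrite -?Eps //= size_rcons ltn_neqAle E.
split => //; rewrite -Eps; apply: sound_dispatch => //=.
- by rewrite all_rcons vr.
- by rewrite all_rcons lexx.
- by rewrite size_rcons E.
Qed.

Lemma sound_close (ps : seq (request R n)) (st : state) (closing : option R) :
  all valid ps -> sound ps st -> (size (waiting st) <= Cap)%N ->
  sound ps (close closing st).
Proof.
move=> vps Hs Hw; rewrite /close; case: closing => // t.
case E: (waiting st) => [//|r w]; rewrite -E.
apply: sound_dispatch => //.
  by case: Hs => _ [served Eps _] _; move: vps; rewrite Eps all_cat => /andP[].
elim: (waiting st) => //= {Hs Hw E} x v IH; rewrite le_max lexx /=.
by apply: sub_all IH => y h; rewrite le_max h orbT.
Qed.

(** * Counting the rounds of SIF *)

Definition nrounds (st : state) : nat := (\sum_i size (starts_of st i))%N.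

Lemma nrounds_dispatch (t : R) (st : state) :
  nrounds (dispatch t st) = (nrounds st).+1.
Proof.
rewrite /nrounds /dispatch /=; set i := pick _ _.
rewrite (bigD1 i) //= eqxx size_rcons addSn [in RHS](bigD1 i) //=.
by congr (_ + _).+1; apply: eq_bigr => j /negPf->.
Qed.

(** Every dispatch of the run removes exactly [Cap] passengers, so rounds and leftover are quotient
    and remainder of the division by [Cap]. *)
Lemma nrounds_run (ps : seq (request R n)) :
  (nrounds (run ps) * Cap + size (waiting (run ps)) = size ps)%N
  /\ (size (waiting (run ps)) < Cap)%N.
Proof.
elim/last_ind: ps => [|ps r [IH IHw]].
  by split=> //=; rewrite /nrounds big1.
rewrite foldl_rcons /arrive /= !size_rcons; set st := run ps in IH IHw *.
case: eqP => [E|/eqP E]; last by rewrite /= size_rcons -IH addnS ltn_neqAle E.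
by rewrite nrounds_dispatch /= addn0 mulSn -IH -E addnC addnS.
Qed.

(** The number of rounds is at most [size ps / Cap] rounded up, in a form that matches the
    conclusion of [rounds_needed]. *)
Lemma nrounds_close (ps : seq (request R n)) (closing : option R) (m : nat) :
  (size ps <= m * Cap)%N -> (nrounds (close closing (run ps)) <= m)%N.
Proof.
have [<- Hw] := nrounds_run ps; set st := run ps in Hw *.
have lem0 : (nrounds st * Cap + size (waiting st) <= m * Cap -> nrounds st <= m)%N.
  by move=> h; rewrite -(leq_pmul2r Cap_gt0) (leq_trans _ h) ?leq_addr.
rewrite /close; case: closing => [t|] //; case E: (waiting st) lem0 => [|r w] //= _ h.
(* Someone is left over, so [nrounds st * Cap] is strictly below [m * Cap]: there is room for the
   closing round. *)
rewrite nrounds_dispatch -(ltn_pmul2r Cap_gt0) (leq_trans _ h) //.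
by rewrite addnS ltnS leq_addr.
Qed.

(** * Feasibility and competitiveness of SIF *)

Lemma total_tour_length_SIF (closing : option R) (sigma : seq (request R n)) :
  total_tour_length len (SIF Cap len pick stops closing sigma)
  = perimeter len *+ nrounds (close closing (run (passengers sigma))).
Proof.
rewrite /total_tour_length /nrounds -sumrMnr; apply: eq_bigr => i _.
exact: tour_length_rounds (size_rounds _ _).
Qed.

Lemma SIF_feasible (closing : option R) (sigma : seq (request R n)) :
  request_sequence sigma -> all valid sigma ->
  closing \/ (Cap %| size (passengers sigma))%N ->
  feasible Cap len sigma (SIF Cap len pick stops closing sigma).
Proof.
move=> /passengers_pairwise srt vs fin.
have vps : all valid (passengers sigma) := all_flatten_nseq _ vs.
have [Hs Hw] := sound_run srt vps.
have [H1 [served Eps H2] H3] := sound_close closing vps Hs (ltnW Hw).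
have W : waiting (close closing (run (passengers sigma))) = [::].
  rewrite /close; case: closing fin {H1 H2 H3 Eps} => [t _|[//|dvd]].
    by case E: (waiting (run (passengers sigma))).
  (* The leftover is a multiple of [Cap] smaller than [Cap], hence zero. *)
  have [E _] := nrounds_run (passengers sigma).
  move: dvd; rewrite -E dvdn_addr ?dvdn_mull // => /dvdn_leq le.
  by apply/nilP; rewrite /nilp eqn0Ngt; apply/negP => /le; rewrite leqNgt Hw.
split=> [i||]; [by case: (H1 i)| |exact: H3].
by rewrite Eps W cats0.
Qed.

Lemma SIF_completes (closing : option R) (scenario : pred (request R n)) :
  (forall r, scenario r -> origin r != destination r -> valid r) ->
  completes Cap len closing scenario (SIF Cap len pick stops closing).
Proof.
move=> h sigma srt sc; apply: SIF_feasible => //; case/andP: srt => _.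
by elim: sigma sc => //= r s IH /andP[/h{}h /IH{}IH] /andP[/h-> /IH].
Qed.

(** The scenario enters through the offset [e] that each ride crosses in some round; [rounds_needed]
    and [nrounds_close] then compare the numbers of rounds. *)
Lemma SIF_competitive (closing : option R) (scenario : pred (request R n)) (e : nat) :
  (forall r, scenario r -> origin r != destination r -> valid r) ->
  (forall (tr : 'I_k -> seq R) r d, scenario r -> serves tr r d ->
    exists q, (board d <= q * n.+1 + e < alight d)%N) ->
  competitive Cap len 1 scenario (SIF Cap len pick stops closing).
Proof.
move=> h hcross sigma srt sc; rewrite mul1r; apply: lb_le_inf.
  (* [Some 0] gives a feasible run for every sequence, whatever [closing] is; any closing time would
     do. *)
  exists (total_tour_length len (SIF Cap len pick stops (Some 0) sigma)).
  exists (SIF Cap len pick stops (Some 0) sigma) => //=.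
  by apply: (SIF_completes h) => //; left.
move=> _ [S [S_tour S_serves S_occ] <-].
rewrite total_tour_length_SIF /total_tour_length.
have Esize i : size (tours S i) = (size (tours S i) %/ n.+1 * n.+1)%N.
  by have [dvd _ _] := S_tour i; rewrite divnK.
under eq_bigr => i _ do rewrite (tour_length_rounds len (Esize i)).
rewrite sumrMnr; apply: ler_wpMn2l; first exact: perimeter_ge0.
apply: nrounds_close; rewrite (size_all2 S_serves).
apply: (rounds_needed (n := n) (e := e)) S_occ _.
apply: sub_all2_all S_serves; last exact: all_flatten_nseq sc.
move=> r d sr /[dup] /(hcross _ _ _ sr)[q /andP[bq qa]] /andP[/andP[_ le_as] _].
apply/existsP.
(* The crossed round belongs to the tour, because the passenger alights after it has begun. *)
have lt_q : (q < size (tours S (vipa d)) %/ n.+1)%N.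
  rewrite -(ltn_pmul2r (ltn0Sn n)) -Esize.
  by apply: leq_trans le_as; apply: leq_ltn_trans qa; apply: leq_addr.
by exists (Ordinal lt_q); rewrite /= bq qa.
Qed.

End Run.

(** * The morning and evening scenarios *)

Lemma inZp_eq0 (n p : nat) : (inZp p == ord0 :> 'I_n.+1) = (n.+1 %| p)%N.
Proof. by []. Qed.

Theorem theorem3 (R : realType) (n k Cap : nat) (len : 'I_n.+1 -> R)
    (len_gt0 : forall i, 0 < len i) (k_gt0 : (0 < k)%N) (Cap_gt0 : (0 < Cap)%N)
    (pick : ('I_k -> seq R) -> R -> 'I_k) (pick_prompt : prompt len pick)
    (closing : option R) :
  [/\ competitive Cap len 1 (@morning R n) (SIF_M Cap len pick closing),
      completes Cap len closing (@morning R n) (SIF_M Cap len pick closing),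
      competitive Cap len 1 (@evening R n) (SIF_E Cap len pick closing)
    & completes Cap len closing (@evening R n) (SIF_E Cap len pick closing)].
Proof.
pose M q (r : request R n) := (q * n.+1, q * n.+1 + destination r)%N.
pose E q (r : request R n) := (q * n.+1 + origin r, q.+1 * n.+1)%N.
have stops_M q (r : request R n) : morning r && (origin r != destination r) ->
    [/\ (q * n.+1 <= (M q r).1)%N, ((M q r).1 < (M q r).2 <= q.+1 * n.+1)%N,
        inZp (M q r).1 = origin r & inZp (M q r).2 = destination r].
  case/andP=> /eqP-> ne; have d_gt0 : (0 < destination r)%N.
    by rewrite lt0n; apply: contra_neq ne => d0; apply: val_inj.
  rewrite /M /=; split=> //; last by rewrite inZp_mulDl valZpK.
    by rewrite -addn1 leq_add2l d_gt0 mulSn addnC leq_add2r ltnW.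
  by apply/eqP; rewrite inZp_eq0 dvdn_mull.
have stops_E q (r : request R n) : evening r && (origin r != destination r) ->
    [/\ (q * n.+1 <= (E q r).1)%N, ((E q r).1 < (E q r).2 <= q.+1 * n.+1)%N,
        inZp (E q r).1 = origin r & inZp (E q r).2 = destination r].
  case/andP=> /eqP-> ne; rewrite /E /=; split; rewrite ?leq_addr //.
  - by rewrite leqnn andbT mulSn addnC ltn_add2r.
  - by rewrite inZp_mulDl valZpK.
  - by apply/eqP; rewrite inZp_eq0 dvdn_mull.
have valid_M (r : request R n) : morning r -> origin r != destination r ->
    morning r && (origin r != destination r) by move=> -> ->.
have valid_E (r : request R n) : evening r -> origin r != destination r ->
    evening r && (origin r != destination r) by move=> -> ->.
split.
- apply: (SIF_competitive (stops := M) len_gt0 Cap_gt0 pick stops_M closing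
            (e := 0%N) valid_M).
  move=> tr r d /eqP v0; rewrite /serves v0 => /and4P[/andP[lt_ba _] + _ _].
  (* Boarding at the parking means boarding at the first move of a round, offset 0. *)
  rewrite inZp_eq0 => /dvdnP[q Eb].
  by exists q; rewrite addn0 -Eb leqnn.
- exact: (SIF_completes (stops := M) len_gt0 Cap_gt0 pick stops_M valid_M).
- apply: (SIF_competitive (stops := E) len_gt0 Cap_gt0 pick stops_E closing
            (e := n) valid_E).
  move=> tr r d /eqP v0; rewrite /serves v0 => /and4P[/andP[lt_ba _] _ + _].
  (* Alighting at [q.+1 * n.+1] comes just after move [q * n.+1 + n], the last one of round [q];
     alighting at position 0 contradicts [lt_ba]. *)
  rewrite inZp_eq0 => /dvdnP[[|q] Ea].
    by rewrite Ea in lt_ba.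
  by exists q; rewrite -ltnS -addnS addnC -mulSn -Ea lt_ba /= Ea mulSn addSn addnC.
- exact: (SIF_completes (stops := E) len_gt0 Cap_gt0 pick stops_E valid_E).
Qed.
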